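(* Let $m=3$ and let $V=(A_1|A_2|A_3)\in\mathbf{B}$. Then $V\in\operatorname{extr}\mathbf{B}$ if and only if at least two of the matrices $A_1,A_2,A_3$ are extreme points of $\mathbf{U}_1$.
   Context: $S^{2}=\{x\in\mathbb{R}^3: x_i\ge 0,\ \sum_{i=1}^3 x_i=1\}$. For $x\in S^{2}$, $x_{[1]}\ge x_{[2]}\ge x_{[3]}$ denotes the nonincreasing rearrangement of the coordinates of $x$; $x\prec y$ means $\sum_{i=1}^k x_{[i]}\le\sum_{i=1}^k y_{[i]}$ for $k=1,2$. A quadratic stochastic operator is a map $V:S^{2}\to S^{2}$ given by $(Vx)_k=\sum_{i,j=1}^3 p_{ij,k}x_ix_j$, where $p_{ij,k}=p_{ji,k}\ge 0$ and $\sum_{k=1}^3 p_{ij,k}=1$; with $A_k=(p_{ij,k})_{i,j=1}^3$ one writes $V=(A_1|A_2|A_3)$. $V$ is doubly stochastic if $Vx\prec x$ for all $x\in S^{2}$, and $\mathbf{B}$ is the set of all doubly stochastic quadratic operators (a convex set, with linear structure given by the coefficients $p_{ij,k}$). $\mathbf{U}_1$ is the set of real $3\times 3$ matrices $A=(a_{ij})$ with $a_{ij}=a_{ji}\ge 0$, $\sum_{i,j\in\alpha}a_{ij}\le|\alpha|$ for all $\alpha\subset \{1,2,3\}$, and $\sum_{i,j=1}^3a_{ij}=3$. $\operatorname{extr}C$ denotes the set of extreme points of a convex set $C$. *)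

(* Defs.v *)
From mathcomp Require Import all_boot all_order all_algebra.
From mathcomp Require Import classical_sets reals.

Set Implicit Arguments.
Unset Strict Implicit.
Unset Printing Implicit Defensive.

Import Order.TTheory GRing.Theory Num.Theory.
Local Open Scope classical_set_scope.
Local Open Scope ring_scope.

Definition extr (R : realType) (E : lmodType R) (C : set E) : set E :=
  [set x | C x /\ forall y z : E, C y -> C z -> forall t : R, 0 < t < 1 ->
    x = t *: y + (1 - t) *: z -> y = x /\ z = x].

Definition simplex (R : realType) (m : nat) : set 'rV[R]_m :=
  [set x | (forall i, 0 <= x 0 i) /\ \sum_i x 0 i = 1].
Arguments simplex : clear implicits.

Definition rearrange (R : realType) (m : nat) (x : 'rV[R]_m) : seq R :=
  sort (fun a b => b <= a) [seq x 0 i | i <- enum 'I_m].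

(* Only used on the simplex, where the totals (k = m) agree automatically. *)
Definition majorized (R : realType) (m : nat) (x y : 'rV[R]_m) : Prop :=
  forall k : nat, (1 <= k < m)%N ->
    \sum_(i < k) (rearrange x)`_i <= \sum_(i < k) (rearrange y)`_i.

(* V = (A_1|...|A_m) is represented by its coefficients, p_{ij,k} = V k i j;
   by the symmetry p_{ij,k} = p_{ji,k} they are determined by the map
   [qapply V]. *)
Definition is_qso (R : realType) (m : nat) (V : {ffun 'I_m -> 'M[R]_m}) : Prop :=
  [/\ forall i j k, V k i j = V k j i,
      forall i j k, 0 <= V k i j
    & forall i j, \sum_k V k i j = 1].

Definition qapply (R : realType) (m : nat) (V : {ffun 'I_m -> 'M[R]_m})
    (x : 'rV[R]_m) : 'rV[R]_m :=
  \row_k \sum_i \sum_j V k i j * x 0 i * x 0 j.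

(* The convex set B of doubly stochastic quadratic operators.  That V maps the
   simplex to itself follows from [is_qso]. *)
Definition dsqo (R : realType) (m : nat) : set {ffun 'I_m -> 'M[R]_m} :=
  [set V | is_qso V /\ forall x, simplex R m x -> majorized (qapply V x) x].
Arguments dsqo : clear implicits.

Definition U1 (R : realType) (m : nat) : set 'M[R]_m :=
  [set A | [/\ forall i j, A i j = A j i,
               forall i j, 0 <= A i j,
               forall alpha : {set 'I_m},
                 \sum_(i in alpha) \sum_(j in alpha) A i j <= #|alpha|%:R
             & \sum_i \sum_j A i j = m%:R]].
Arguments U1 : clear implicits.

(* Main.v *)
Require Import Defs.
From mathcomp Require Import all_boot all_order all_algebra.
From mathcomp Require Import classical_sets reals.
From mathcomp Require Import boolp ring lra.

Set Implicit Arguments.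
Unset Strict Implicit.
Unset Printing Implicit Defensive.

Import Order.TTheory GRing.Theory Num.Theory.
Local Open Scope ring_scope.

(** The key is that an extreme point of B has entries in {0, 1/2, 1}.

    For m = 3 every A in U_1 is the symmetric part (b + b^T)/2 of a row
    stochastic matrix b ([U1_split]).  Hence x A x^T is an iterated average of
    the coordinates of x and lies between their extreme values, which for
    three coordinates is all that majorization asks: B consists of the
    quadratic stochastic operators whose matrices all lie in U_1 ([dsqo3P]).

    Consequently V in B is a transport plan: there are nine sources (k, h),
    each with one unit to send, and nine cells (i, j), each receiving one unit,
    where (k, h) may only serve cells in row or column h; the entry p_{ij,k} is
    the mean of what the sources (k, _) send to (i, j) and to (j, i).  By Hall's
    theorem the support of such a plan contains a permutation, and removing a
    small multiple of it leaves, after rescaling, another plan.  Thus every V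
    in B is a proper convex combination of a permutation plan and an element
    of B, and if V is extreme it is itself given by a permutation
    ([extr_dsqo_perm]); its entries are then half-integral.

    It remains to see which half-integral points of U_1 are not extreme.
    A perturbation can only move an off-diagonal entry a_ij = 1/2 with
    a_ii = a_jj = 0, and the fixed total forces at least two of them to move;
    then all diagonal entries vanish and A is the matrix C with zero
    diagonal and all other entries 1/2 ([half_integral_extr]).  Finally C
    cannot occur twice in an extreme V: writing C + C = A + A' with A, A' in
    U_1 different from C, the two occurrences can be replaced by (A, A') or by
    (A', A), and V is the midpoint of the results ([extr_dsqo_center]).  So at
    most one of the three matrices fails to be extreme.

    Conversely, two extreme matrices do not change under a decomposition of
    V, and the third one is determined by A_1 + A_2 + A_3 = J
    ([extr_dsqo_of_two]). *)

(** * Hall's theorem *)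

(** Hall's marriage theorem, by Rado's argument: as long as some [N x] has two
    elements, one of them can be deleted without violating the condition.
    Otherwise both deletions create deficient sets, and submodularity of the
    size of a union contradicts the condition for the union and the
    intersection of these two sets. *)
Lemma hall (X Y : finType) (N : X -> {set Y}) :
  (forall S : {set X}, (#|S| <= #|\bigcup_(x in S) N x|)%N) ->
  exists2 f : X -> Y, injective f & forall x, f x \in N x.
Proof.
have [n] := ubnP (\sum_x #|N x|)%N; elim: n N => // n IHn N ltNn hallN.
have cardN x : (0 < #|N x|)%N by have := hallN [set x]; rewrite cards1 big_set1.
have [/existsP[x /card_gt1P[y1 [y2 [Ny1 Ny2 ne_y]]]] | /existsPn small] :=
    boolP [exists x, 1 < #|N x|]%N; last first.
  have NE x : exists y, N x == [set y].
    have /cards1P[y ->] : #|N x| == 1%N by rewrite eqn_leq cardN leqNgt small.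
    by exists y.
  pose f x := xchoose (NE x).
  have fE x : N x = [set f x] by apply/eqP/(xchooseP (NE x)).
  exists f => [x x' eqf|x]; last by rewrite fE set11.
  apply/eqP/contraT => nex; have := hallN [set x; x'].
  by rewrite cards2 nex finset.bigcup_setU !big_set1 !fE -eqf finset.setUid cards1.
pose N' y z := if z == x then N x :\ y else N z.
have bigN' (y : Y) (S : {set X}) : x \notin S -> \bigcup_(z in S) N' y z = \bigcup_(z in S) N z.
  by move=> xS; apply: eq_bigr => z zS; rewrite /N' (negPf (memPn xS z zS)).
(* Deleting [y] from [N x] is harmless unless a set containing [x] becomes
   deficient. *)
have shrink y : y \in N x ->
    (forall S : {set X}, x \notin S ->
       (#|S| < #|(N x :\ y) :|: \bigcup_(z in S) N z|)%N) ->
  exists2 f : X -> Y, injective f & forall z, f z \in N z.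
  move=> Ny hallS; have [||f injf fN'] := IHn (N' y).
  - rewrite -ltnS; apply: leq_trans ltNn; rewrite ltnS [X in (_ <= X)%N](bigD1 x) //= (bigD1 x) //=.
    rewrite -addSn leq_add //.
      by rewrite /N' eqxx [#|N x|](cardsD1 y) Ny.
    by apply: leq_sum => z nez; rewrite /N' (negPf nez).
  - move=> S; have [xS|/bigN'->//] := boolP (x \in S).
    rewrite (big_setD1 x) //= bigN' ?setD11 // {1}/N' eqxx (cardsD1 x) xS.
    by apply: hallS; rewrite setD11.
  - exists f => // z; have := fN' z; rewrite /N'; case: eqP => // ->.
    by rewrite !inE => /andP[].
have [/forallP good1|/forallPn[S1]] := boolP [forall S : {set X}, (x \notin S) ==>
     (#|S| < #|(N x :\ y1) :|: \bigcup_(z in S) N z|)%N].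
  by apply: (shrink y1) => // S; apply/implyP.
have [/forallP good2|/forallPn[S2]] := boolP [forall S : {set X}, (x \notin S) ==>
     (#|S| < #|(N x :\ y2) :|: \bigcup_(z in S) N z|)%N].
  by move=> _; apply: (shrink y2) => // S; apply/implyP.
rewrite !negb_imply -!leqNgt => /andP[xS2 bad2] /andP[xS1 bad1].
set U1 := _ :|: _ in bad1; set U2 := _ :|: _ in bad2.
have hU : (#|S1 :|: S2|.+1 <= #|U1 :|: U2|)%N.
  have := hallN (x |: (S1 :|: S2)); rewrite cardsU1 inE negb_or xS1 xS2 => /leq_trans-> //.
  apply/subset_leq_card/bigcupsP => z; rewrite !inE => /or3P[/eqP->|zS|zS].
  - apply/fintype.subsetP => y Ny; rewrite !inE Ny !andbT.
    by have [->|] := eqVneq y y1; rewrite ?ne_y ?orbT.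
  - by apply/fintype.subsetP=> y Ny; rewrite !inE (_ : y \in \bigcup_(_ in S1) _) ?orbT //; apply/bigcupP; exists z.
  - by apply/fintype.subsetP=> y Ny; rewrite !inE (_ : y \in \bigcup_(_ in S2) _) ?orbT //; apply/bigcupP; exists z.
have hI : (#|S1 :&: S2| <= #|U1 :&: U2|)%N.
  apply: leq_trans (hallN _) _; apply/subset_leq_card/bigcupsP => z.
  rewrite inE => /andP[zS1 zS2]; apply/fintype.subsetP=> y Ny; rewrite !inE.
  by apply/andP; split; apply/orP; right; apply/bigcupP; exists z.
have := leq_add hU hI; rewrite addSn !cardsUI ltnNge.
by rewrite leq_add.
Qed.

(** * Extreme points *)

(** It suffices to test symmetric perturbations: if x = t y + (1 - t) z, then
    x + d and x - d with d = t (1 - t) (y - z) still lie on the segment [y, z]. *)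
Lemma extr_midpoint (R : realType) (E : lmodType R) (C : set E) (x : E) :
  (forall y z t, C y -> C z -> 0 <= t <= 1 -> C (t *: y + (1 - t) *: z)) ->
  C x -> (forall d, C (x + d) -> C (x - d) -> d = 0) -> extr C x.
Proof.
move=> convC Cx dx; split=> // y z Cy Cz t /andP[t0 t1] xE.
have yz : y = z.
  apply/eqP; rewrite -subr_eq0.
  have := dx ((t * (1 - t)) *: (y - z)).
  have -> : x + (t * (1 - t)) *: (y - z) = (t + t * (1 - t)) *: y + (1 - (t + t * (1 - t))) *: z.
    rewrite xE scalerBr addrACA -scalerDl -scalerBl.
    by congr (_ + _ *: _); ring.
  have -> : x - (t * (1 - t)) *: (y - z) = (t * t) *: y + (1 - t * t) *: z.
    rewrite xE scalerBr opprB [_ *: z - _]addrC addrACA -scalerBl -scalerDl.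
    by congr (_ *: _ + _ *: _); ring.
  move=> /(_ (convC _ _ _ Cy Cz _) (convC _ _ _ Cy Cz _)) H.
  have /eqP : (t * (1 - t)) *: (y - z) = 0.
    have [p q r] : [/\ 0 < t * (1 - t), 0 < t * t & 0 < (1 - t) * (1 - t)].
      by rewrite !mulr_gt0 ?subr_gt0.
    by apply: H; apply/andP; split; lra.
  by rewrite scaler_eq0 mulf_eq0 !gt_eqF ?subr_gt0.
by rewrite xE yz -scalerDl addrC subrK scale1r.
Qed.

(** * Nonincreasing rearrangements *)

Section Rearrange.
Variables (R : realType) (m : nat).
Implicit Type x : 'rV[R]_m.

Lemma perm_rearrange x : perm_eq (rearrange x) [seq x 0 i | i <- enum 'I_m].
Proof. by rewrite perm_sort. Qed.

Lemma size_rearrange x : size (rearrange x) = m.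
Proof. by rewrite size_sort size_map size_enum_ord. Qed.

Lemma rearrange_nth x k : (k < m)%N -> exists i, (rearrange x)`_k = x 0 i.
Proof.
move=> km; have : (rearrange x)`_k \in rearrange x by rewrite mem_nth ?size_rearrange.
by rewrite (perm_mem (perm_rearrange x)) => /mapP[i _ ->]; exists i.
Qed.

Lemma sum_rearrange x : \sum_(k < m) (rearrange x)`_k = \sum_i x 0 i.
Proof.
transitivity (\sum_(a <- rearrange x) a).
  by rewrite (big_nth 0) size_rearrange big_mkord.
by rewrite (perm_big _ (perm_rearrange x)) big_map big_enum.
Qed.

Lemma nth_rearrange_le x j k : (j <= k < m)%N -> (rearrange x)`_k <= (rearrange x)`_j.
Proof.
move=> /andP[jk km]; have geT : total (fun a b : R => b <= a) by move=> a b; exact: le_total.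
have geTr : transitive (fun a b : R => b <= a) by move=> a b c ba ac; exact: le_trans ac ba.
apply: (sorted_leq_nth geTr _ 0 (sort_sorted geT _)); rewrite ?inE ?size_rearrange //.
exact: leq_ltn_trans km.
Qed.

Lemma nth_rearrangeE x i : exists2 k, (k < m)%N & x 0 i = (rearrange x)`_k.
Proof.
have : x 0 i \in rearrange x by rewrite (perm_mem (perm_rearrange x)) map_f ?mem_enum.
by case/(nthP 0) => k; rewrite size_rearrange; exists k.
Qed.

Lemma rearrange_max x i : x 0 i <= (rearrange x)`_0.
Proof. by have [k km ->] := nth_rearrangeE x i; exact: nth_rearrange_le. Qed.

Lemma rearrange_min x i : (rearrange x)`_m.-1 <= x 0 i.
Proof. 
have [k km ->] := nth_rearrangeE x i; apply: nth_rearrange_le.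
by case: m km => // n; rewrite ltnS => -> /=.
Qed.
End Rearrange.

(** * Symmetric parts of stochastic matrices *)

Lemma sum3 (V : nmodType) (F : 'I_3 -> V) : \sum_i F i = F 0 + F 1 + F 2.
Proof.
rewrite !big_ord_recl big_ord0 addr0 addrA.
by congr (F _ + F _ + F _); apply: val_inj.
Qed.

Lemma forall3 (P : 'I_3 -> Prop) : P 0 -> P 1 -> P 2 -> forall i, P i.
Proof.
by move=> P0 P1 P2 [[|[|[|//]]] lti]; [move: P0|move: P1|move: P2]; congr P; apply: val_inj.
Qed.

Definition row_stochastic (R : realType) (m : nat) (b : 'M[R]_m) :=
  (forall i j, 0 <= b i j) /\ (forall i, \sum_j b i j = 1).

Definition sym_part (R : realType) (m : nat) (b : 'M[R]_m) : 'M[R]_m :=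
  2^-1 *: (b + b^T).

Lemma sum_sym_part (R : realType) (m : nat) (b : 'M[R]_m) (P : pred 'I_m) :
  \sum_(i | P i) \sum_(j | P j) sym_part b i j =
  \sum_(i | P i) \sum_(j | P j) b i j.
Proof.
transitivity (2^-1 * (\sum_(i | P i) \sum_(j | P j) b i j +
                      \sum_(i | P i) \sum_(j | P j) b j i)).
  rewrite -big_split mulr_sumr; apply: eq_bigr => i _.
  rewrite -big_split mulr_sumr; apply: eq_bigr => j _.
  by rewrite !mxE.
by rewrite [X in _ * (_ + X)]exchange_big /=; lra.
Qed.

Lemma sym_part_sym (R : realType) (m : nat) (b : 'M[R]_m) i j :
  sym_part b i j = sym_part b j i.
Proof. by rewrite !mxE addrC. Qed.

Lemma sym_part_ge0 (R : realType) (m : nat) (b : 'M[R]_m) i j :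
  (forall i j, 0 <= b i j) -> 0 <= sym_part b i j.
Proof. by move=> b0; rewrite !mxE mulr_ge0 ?invr_ge0 ?addr_ge0. Qed.

Lemma U1_sym_part (R : realType) (m : nat) (b : 'M[R]_m) :
  row_stochastic b -> U1 R m (sym_part b).
Proof.
move=> [b0 b1]; split=> [i j|i j|alpha|].
- exact: sym_part_sym.
- exact: sym_part_ge0.
- rewrite sum_sym_part -sum1_card natr_sum ler_sum // => i _.
  rewrite -(b1 i) [leRHS](bigID (mem alpha)) /= lerDl.
  exact: sumr_ge0.
- by rewrite sum_sym_part (eq_bigr (fun=> 1)) // sumr_const card_ord.
Qed.

Section U1.
Variables (R : realType).
Implicit Types A : 'M[R]_3.

Lemma U1_diag_le1 (m : nat) (A : 'M[R]_m) i : U1 R m A -> A i i <= 1.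
Proof. by case=> _ _ /(_ [set i])%SET + _; rewrite !big_set1 cards1. Qed.

Lemma U1_pair_le2 (m : nat) (A : 'M[R]_m) i j : U1 R m A -> i != j ->
  A i i + A j j + 2 * A i j <= 2.
Proof.
case=> symA _ + _ neij; move=> /(_ [set i; j]%SET); rewrite cards2 neij /=.
have sumE (F : 'I_m -> R) : \sum_(h in [set i; j]%SET) F h = F i + F j.
  by rewrite big_setU1 ?inE //= big_set1.
by rewrite !sumE (symA j i); lra.
Qed.

Lemma U1_total A : U1 R 3 A ->
  A 0 0 + A 1 1 + A 2 2 + 2 * (A 0 1 + A 0 2 + A 1 2) = 3.
Proof. by case=> symA _ _; rewrite !sum3 !(symA 2) !(symA 1 0); lra. Qed.

(** If the total 2 a_ij of each symmetric pair is thought of as being divided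
    between its two vertices, a row stochastic [b] is a division that gives each
    vertex exactly 1.  The three vertex equations leave one free parameter [t],
    the share of vertex 0 in the pair {0, 2}, and the inequalities defining
    U_1 say that its lower bounds are at most its upper bounds. *)
Lemma U1_split A : U1 R 3 A -> exists2 b, row_stochastic b & A = sym_part b.
Proof.
move=> hA; have [symA A0 _ _] := hA.
have tot := U1_total hA.
have p01 := @U1_pair_le2 _ _ 0 1 hA isT.
have p02 := @U1_pair_le2 _ _ 0 2 hA isT.
have p12 := @U1_pair_le2 _ _ 1 2 hA isT.
have d0 := U1_diag_le1 0 hA; have d1 := U1_diag_le1 1 hA; have d2 := U1_diag_le1 2 hA.
have n00 := A0 0 0; have n11 := A0 1 1; have n22 := A0 2 2.
have n01 := A0 0 1; have n02 := A0 0 2; have n12 := A0 1 2.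
have [t ht] : exists t, [/\ 0 <= t, t <= 1 - A 0 0, 1 - A 0 0 - 2 * A 0 1 <= t
  & [/\ t <= 2 - A 0 0 - A 1 1 - 2 * A 0 1, t <= 2 * A 0 2 & 2 * A 0 2 - 1 + A 2 2 <= t]].
  exists (Num.max 0 (Num.max (1 - A 0 0 - 2 * A 0 1) (2 * A 0 2 - 1 + A 2 2))).
  by rewrite !ge_max !le_max !lexx ?orbT; split=> //; try split=> //; apply/and3P; split; lra.
case: ht => t1 t2 t3 [t4 t5 t6].
pose b : 'M[R]_3 := \matrix_(i, j) nth 0 (nth [::]
  [:: [:: A 0 0; 1 - A 0 0 - t; t];
      [:: 2 * A 0 1 - 1 + A 0 0 + t; A 1 1; 2 - A 0 0 - A 1 1 - 2 * A 0 1 - t];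
      [:: 2 * A 0 2 - t; 2 * A 0 1 + 2 * A 1 2 - (2 - A 0 0 - A 1 1 - t); A 2 2]] i) j.
have eqb := (symA 1 0, symA 2 0, symA 2 1).
exists b.
  split; first by do 2!apply: forall3; rewrite !mxE /=; lra.
  by apply: forall3; rewrite sum3 !mxE /=; lra.
by apply/matrixP; do 2!apply: forall3; rewrite !mxE /= ?eqb; lra.
Qed.
End U1.

(** * Doubly stochastic operators of dimension three *)

Section Dsqo.
Variable R : realType.

Lemma sym_part_quad (m : nat) (b : 'M[R]_m) (x : 'rV[R]_m) :
  \sum_i \sum_j sym_part b i j * x 0 i * x 0 j =
  \sum_i x 0 i * \sum_j b i j * x 0 j.
Proof.
pose f i j := b i j * x 0 i * x 0 j.
transitivity (2^-1 * (\sum_i \sum_j f i j + \sum_i \sum_j f j i)).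
  rewrite -big_split mulr_sumr; apply: eq_bigr => i _.
  rewrite -big_split mulr_sumr; apply: eq_bigr => j _.
  by rewrite !mxE /f /=; ring.
rewrite [X in _ + X]exchange_big /=.
transitivity (\sum_i \sum_j f i j); first by lra.
by apply: eq_bigr => i _; rewrite mulr_sumr; apply: eq_bigr => j _; rewrite /f; ring.
Qed.

Lemma average_bounds (I : finType) (w f : I -> R) (lo hi : R) :
  (forall i, 0 <= w i) -> \sum_i w i = 1 -> (forall i, lo <= f i <= hi) ->
  lo <= \sum_i w i * f i <= hi.
Proof.
move=> w0 w1 fb; rewrite -[lo]mul1r -[hi]mul1r -w1 !mulr_suml.
by apply/andP; split; apply: ler_sum => i _; rewrite ler_wpM2l //; case/andP: (fb i).
Qed.

(** By [sym_part_quad] the value is an average, weighted by [x], of averages of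
    [x] weighted by the rows of [b]. *)
Lemma U1_quad_bounds (A : 'M[R]_3) (x : 'rV[R]_3) lo hi :
  U1 R 3 A -> simplex R 3 x -> (forall i, lo <= x 0 i <= hi) ->
  lo <= \sum_i \sum_j A i j * x 0 i * x 0 j <= hi.
Proof.
move=> /U1_split[b [b0 b1] ->] [x0 x1] xb; rewrite sym_part_quad.
by apply: average_bounds => // i; apply: average_bounds.
Qed.

Lemma sum_qapply (m : nat) (V : {ffun 'I_m -> 'M[R]_m}) (x : 'rV[R]_m) :
  is_qso V -> \sum_i x 0 i = 1 -> \sum_k qapply V x 0 k = 1.
Proof.
move=> [_ _ V1] x1; under eq_bigr do rewrite mxE.
rewrite exchange_big -[RHS]x1; apply: eq_bigr => i _.
rewrite exchange_big -[RHS]mulr1 -[in RHS]x1 mulr_sumr; apply: eq_bigr => j _ /=.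
by rewrite -!mulr_suml V1 mul1r.
Qed.

(** Testing majorization on the uniform distribution over [alpha] bounds the
    sum over [alpha] by its size.  The totals are thus at most [m]; as they add
    up to m^2, each of them equals [m]. *)
Lemma dsqo_U1 (m : nat) (V : {ffun 'I_m -> 'M[R]_m}) k : (1 < m)%N ->
  dsqo R m V -> U1 R m (V k).
Proof.
move=> m1 [qV majV]; have [symV V0 V1] := qV.
pose u (alpha : {set 'I_m}) : 'rV[R]_m := \row_i (#|alpha|%:R^-1 *+ (i \in alpha)).
have uE (alpha : {set 'I_m}) l : qapply V (u alpha) 0 l =
   #|alpha|%:R^-1 ^+ 2 * \sum_(i in alpha) \sum_(j in alpha) V l i j.
  rewrite mxE mulr_sumr [RHS]big_mkcond; apply: eq_bigr => i _ /=.
  rewrite mxE; case: ifP => ia; last by rewrite big1 // => j _; rewrite mulr0n mulr0 mul0r.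
  rewrite mulr_sumr [RHS]big_mkcond; apply: eq_bigr => j _ /=.
  by rewrite mxE; case: ifP => ja; rewrite ?mulr0n ?mulr0 // !mulr1n; ring.
have u_simplex (alpha : {set 'I_m}) : alpha != finset.set0 -> simplex R m (u alpha).
  rewrite -card_gt0 => a0; split=> [i|].
    by rewrite mxE mulrn_wge0 // invr_ge0 ler0n.
  under eq_bigr do rewrite mxE mulrb.
  by rewrite -big_mkcond sumr_const -[LHS]mulr_natr mulVf // pnatr_eq0 -lt0n.
have uV (alpha : {set 'I_m}) l : alpha != finset.set0 ->
    qapply V (u alpha) 0 l <= #|alpha|%:R^-1.
  move=> a0; have := majV _ (u_simplex _ a0) 1%N m1; rewrite !big_ord1.
  move=> /(le_trans (rearrange_max _ l))/le_trans; apply.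
  have [i ->] := rearrange_nth (u alpha) (ltnW m1).
  by rewrite mxE mulrb; case: ifP => _; rewrite ?invr_ge0.
have leU (alpha : {set 'I_m}) l : \sum_(i in alpha) \sum_(j in alpha) V l i j <= #|alpha|%:R.
  have [->|a0] := eqVneq alpha finset.set0; first by rewrite big_set0 cards0.
  have := uV _ l a0; rewrite uE.
  have c0 : 0 < #|alpha|%:R :> R by rewrite ltr0n card_gt0.
  by rewrite expr2 -mulrA ger_pMr ?invr_gt0 // mulrC ler_pdivrMr // mul1r.
split=> //.
have leT l : \sum_i \sum_j V l i j <= m%:R.
  have := leU finset.setT l; rewrite cardsT card_ord.
  by under eq_bigl do rewrite finset.in_setT; under eq_bigr do under eq_bigl do rewrite finset.in_setT.
have tot : \sum_l \sum_i \sum_j V l i j = \sum_(l < m) m%:R.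
  rewrite exchange_big; apply: eq_bigr => i _; rewrite exchange_big /=.
  by rewrite (eq_bigr (fun=> 1)) // sumr_const card_ord.
move: tot; rewrite (bigD1 k) //= [RHS](bigD1 k) //= => tot.
have := ler_sum (index_enum 'I_m) (P := predC1 k) (fun l _ => leT l).
apply: contraTeq; rewrite -ltNge => neq.
have lt_k : \sum_i \sum_j V k i j < m%:R by rewrite lt_neqAle neq leT.
rewrite /= in tot *.
by move: tot lt_k; lra.
Qed.

(** For three coordinates with a fixed sum, majorization compares only the
    largest and the smallest ones, which [U1_quad_bounds] controls. *)
Lemma dsqo3P (V : {ffun 'I_3 -> 'M[R]_3}) :
  dsqo R 3 V <-> is_qso V /\ forall k, U1 R 3 (V k).
Proof.
split=> [dV|[qV UV]]; first by split=> [|k]; [case: dV | exact: dsqo_U1].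
split=> // x sx [//|k] /andP[_ k3]; set y := qapply V x.
have yb k' : (rearrange x)`_2 <= y 0 k' <= (rearrange x)`_0.
  rewrite mxE; apply: U1_quad_bounds => // i.
  by rewrite rearrange_min rearrange_max.
have sumE (z : 'rV[R]_3) : (rearrange z)`_0 + (rearrange z)`_1 + (rearrange z)`_2 = \sum_i z 0 i.
  by rewrite -sum_rearrange !big_ord_recr big_ord0 /= add0r.
have eqs := sumE y; rewrite sum_qapply // in eqs; last by case: sx.
have eqx := sumE x; have [_ x1] := sx; rewrite x1 in eqx.
case: k k3 => [|[|//]] _; rewrite !big_ord_recr !big_ord0 /= !add0r.
  by have [l ->] := rearrange_nth y (isT : (0 < 3)%N); case/andP: (yb l).
have [l yl] := rearrange_nth y (isT : (2 < 3)%N).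
by have := yb l; rewrite -yl; lra.
Qed.
End Dsqo.

(** * Transport plans *)

Section Plans.
Variables (R : realType) (m : nat).

(** Used both for the targets (i, j) of a transport plan and for its sources
    (k, h), where [k] names one of the matrices and [h] a vertex. *)
Definition cell := ('I_m * 'I_m)%type.

Definition plan (M : cell -> cell -> R) : Prop :=
  [/\ forall s c, 0 <= M s c, forall s, \sum_c M s c = 1, forall c, \sum_s M s c = 1
    & forall s c, M s c != 0 -> (s.2 == c.1) || (s.2 == c.2)].

Definition flow (M : cell -> cell -> R) (k : 'I_m) : 'M[R]_m :=
  \matrix_(i, j) \sum_h M (k, h) (i, j).

Definition qso_of_plan (M : cell -> cell -> R) : {ffun 'I_m -> 'M[R]_m} :=
  [ffun k => sym_part (flow M k)].

Lemma qso_of_planE M k i j :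
  qso_of_plan M k i j = 2^-1 * (\sum_h M (k, h) (i, j) + \sum_h M (k, h) (j, i)).
Proof. by rewrite ffunE !mxE. Qed.

Lemma qso_of_plan_convex M M' M'' t :
  (forall s c, M s c = t * M' s c + (1 - t) * M'' s c) ->
  qso_of_plan M = t *: qso_of_plan M' + (1 - t) *: qso_of_plan M''.
Proof.
move=> ME; apply/ffunP => k; apply/matrixP => i j.
have sumE c : \sum_h M (k, h) c = t * \sum_h M' (k, h) c + (1 - t) * \sum_h M'' (k, h) c.
  by rewrite !mulr_sumr -big_split; apply: eq_bigr.
by rewrite ffunE !ffunE !mxE !sumE; ring.
Qed.

Lemma sum_cell (F : cell -> R) : \sum_s F s = \sum_k \sum_h F (k, h).
Proof. by rewrite pair_big; apply: eq_bigr => -[]. Qed.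

Lemma qso_of_plan_qso M : plan M -> is_qso (qso_of_plan M).
Proof.
move=> [M0 _ M1 _]; split=> [i j k|i j k|i j].
- by rewrite !ffunE sym_part_sym.
- by rewrite !ffunE sym_part_ge0 // => {}i {}j; rewrite mxE sumr_ge0.
under eq_bigr do rewrite qso_of_planE.
have colE c : \sum_k \sum_h M (k, h) c = 1 by rewrite -(sum_cell (M^~ c)) M1.
by rewrite -mulr_sumr big_split /= !colE; lra.
Qed.

(** The inequality for [alpha] holds because only the sources (k, h) with
    h in [alpha] can reach cells inside [alpha], and each of them has one unit. *)
Lemma qso_of_plan_U1 M k : plan M -> U1 R m (qso_of_plan M k).
Proof.
move=> planM; have [symV V0 _] := qso_of_plan_qso planM.
have [M0 rowM _ suppM] := planM.
have sumE (P : pred 'I_m) : \sum_(i | P i) \sum_(j | P j) qso_of_plan M k i j =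
    \sum_h \sum_(i | P i) \sum_(j | P j) M (k, h) (i, j).
  rewrite ffunE sum_sym_part [RHS]exchange_big; apply: eq_bigr => i _.
  by rewrite [RHS]exchange_big; apply: eq_bigr => j _; rewrite mxE.
split=> // [alpha|]; rewrite sumE; last first.
  under eq_bigr => h _ do rewrite -(sum_cell (M (k, h))) rowM.
  by rewrite sumr_const card_ord.
rewrite -sum1_card natr_sum [leRHS]big_mkcond ler_sum // => h _ /=.
have [ha|ha] := boolP (h \in alpha).
  rewrite -(rowM (k, h)) sum_cell big_mkcond ler_sum // => i _.
  case: ifP => _; last exact: sumr_ge0.
  by rewrite big_mkcond ler_sum // => j _; case: ifP.
rewrite big1 // => i ia; rewrite big1 // => j ja.
apply: contraNeq ha => /suppM/= /orP[] /eqP-> //.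
Qed.

(** The source (k, h) sends half of [b k h j] to each of the cells (h, j) and
    (j, h); then (i, j) receives p_{ij,k} from the sources of the matrix [k],
    and these entries sum to 1 over [k]. *)
Lemma plan_of_splitting (V b : 'I_m -> 'M[R]_m) :
  (forall i j, \sum_k V k i j = 1) ->
  (forall k, row_stochastic (b k)) -> (forall k, V k = sym_part (b k)) ->
  exists2 M, plan M & forall k, qso_of_plan M k = V k.
Proof.
move=> V1 bP VE.
pose M (s c : cell) :=
  2^-1 * (b s.1 s.2 c.2 *+ (c.1 == s.2) + b s.1 s.2 c.1 *+ (c.2 == s.2)).
have pick (F : 'I_m -> R) i : \sum_h F h *+ (i == h) = F i.
  by rewrite (bigD1 i) //= eqxx big1 ?addr0 // => h; rewrite eq_sym => /negPf->.
have colM k i j : \sum_h M (k, h) (i, j) = V k i j.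
  by rewrite VE !mxE -mulr_sumr big_split /= !pick.
exists M.
  split=> [s c|[k h]|[i j]|s c].
  - by have [b0 _] := bP s.1; rewrite mulr_ge0 ?invr_ge0 ?addr_ge0 ?mulrn_wge0.
  - have [_ b1] := bP k; rewrite sum_cell.
    transitivity (2^-1 * (\sum_i (\sum_j b k h j) *+ (h == i) +
                          \sum_j (\sum_i b k h i) *+ (h == j))).
      rewrite [X in _ = _ * (_ + X)](eq_bigr (fun j => \sum_i b k h i *+ (h == j))); last first.
        by move=> j _; rewrite sumrMnl.
      rewrite [X in _ = _ * (_ + X)]exchange_big -big_split mulr_sumr /=.
      apply: eq_bigr => i _; rewrite -sumrMnl -big_split mulr_sumr.
      by apply: eq_bigr => j _; rewrite /M /= ![_ == h]eq_sym.
    by rewrite !pick b1; lra.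
  - by rewrite sum_cell; under eq_bigr do rewrite colM.
  - rewrite ![s.2 == _]eq_sym; apply: contraNT; rewrite negb_or => /andP[/negPf n1 /negPf n2].
    by rewrite /M n1 n2 !mulr0n addr0 mulr0.
move=> k; apply/matrixP => i j; rewrite qso_of_planE !colM !VE sym_part_sym.
by lra.
Qed.

Definition perm_plan (sigma : cell -> cell) (s c : cell) : R := (sigma s == c)%:R.

Lemma perm_planP sigma : injective sigma ->
  (forall s, (s.2 == (sigma s).1) || (s.2 == (sigma s).2)) -> plan (perm_plan sigma).
Proof.
move=> inj supp; split=> [s c|s|c|s c].
- exact: ler0n.
- by rewrite (bigD1 (sigma s)) //= /perm_plan eqxx big1 ?addr0 // => c; rewrite eq_sym => /negPf->.
- have [tau sigmaK tauK] := injF_bij inj.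
  rewrite (bigD1 (tau c)) //= /perm_plan tauK eqxx big1 ?addr0 // => s.
  by rewrite -(can_eq sigmaK) tauK => nes; rewrite (negPf nes).
- by rewrite /perm_plan; case: (eqVneq (sigma s) c) => [<-|]; rewrite ?supp ?eqxx.
Qed.
End Plans.

(** Hall's condition for the support: the mass sent by [S] is [#|S|], and it
    arrives in the neighbourhood of [S], where each point receives at most 1. *)
Lemma positive_permutation (R : realType) (X : finType) (M : X -> X -> R) :
  (forall x y, 0 <= M x y) -> (forall x, \sum_y M x y = 1) ->
  (forall y, \sum_x M x y = 1) ->
  exists2 sigma : X -> X, injective sigma & forall x, 0 < M x (sigma x).
Proof.
move=> M0 rowM colM.
have [|sigma inj pos] := @hall X X (fun x => [set y | 0 < M x y]%SET).
  move=> S; set N := (\bigcup_(x in S) _)%SET; rewrite -(ler_nat R).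
  rewrite -!sum1_card !natr_sum.
  apply: (@le_trans _ _ (\sum_(x in S) \sum_(y in N) M x y)).
    apply: ler_sum => x xS; rewrite -(rowM x) [leLHS](bigID (mem N)) /=.
    rewrite [X in _ + X]big1 ?addr0 // => y yN; apply: contraNeq yN => nz.
    by apply/bigcupP; exists x => //; rewrite inE lt_neqAle eq_sym nz M0.
  rewrite exchange_big; apply: ler_sum => y _ /=.
  rewrite -(colM y) [leRHS](bigID (mem S)) /= lerDl.
  by rewrite sumr_ge0.
by exists sigma => // x; have := pos x; rewrite inE.
Qed.

(** A permutation in the support of the plan can be split off with a positive
    weight, so that an extreme point must coincide with it. *)
Lemma extr_dsqo_perm (R : realType) (V : {ffun 'I_3 -> 'M[R]_3}) :
  extr (dsqo R 3) V ->
  exists sigma : cell 3 -> cell 3, injective sigma /\ V = qso_of_plan (perm_plan R sigma).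
Proof.
move=> [/dsqo3P[qV UV] extrV].
have [b bP] := choice (fun k => let: ex_intro2 b p q := U1_split (UV k) in ex_intro _ b (conj p q)).
have [_ _ V1] := qV.
have [M planM VM] := plan_of_splitting V1 (fun k => (bP k).1) (fun k => (bP k).2).
have [M0 rowM colM suppM] := planM.
have [sigma inj pos] := positive_permutation M0 rowM colM.
have planP : plan (perm_plan R sigma).
  by apply: perm_planP => // s; apply/suppM/lt0r_neq0.
have leM1 s c : M s c <= 1 by rewrite -(rowM s) (bigD1 c) //= lerDl sumr_ge0.
have [t [t0 t1 tM]] : exists t : R, [/\ 0 < t, t < 1 & forall s, t <= M s (sigma s)].
  (* All entries being at most 1, their product is below each of them; the
     factor 1/2 keeps the weight below 1. *)
  exists (2^-1 * \prod_s M s (sigma s)).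
  have p0 : 0 < \prod_s M s (sigma s) by rewrite prodr_gt0.
  have pM s : \prod_s M s (sigma s) <= M s (sigma s).
    rewrite (bigD1 s) //= ger_pMr //.
    by apply: prodr_ile1 => s' _; rewrite M0 leM1.
  split=> [||s]; first by lra.
    by have := pM (0, 0); have := leM1 (0, 0) (sigma (0, 0)); lra.
  by have := pM s; lra.
have t1' : 1 - t != 0 by rewrite subr_eq0 eq_sym lt_eqF.
pose M' s c := (M s c - t * perm_plan R sigma s c) / (1 - t).
have ME s c : M s c = t * perm_plan R sigma s c + (1 - t) * M' s c.
  by rewrite /M' mulrCA divff // mulr1 addrC subrK.
have planM' : plan M'.
  have [P0 rowP colP suppP] := planP.
  split=> [s c|s|c|s c].
  - rewrite divr_ge0 ?subr_ge0 ?(ltW t1) // /perm_plan; case: (eqVneq (sigma s) c) => [<-|_].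
      by rewrite mulr1.
    by rewrite mulr0.
  - by rewrite -mulr_suml sumrB -mulr_sumr rowM rowP mulr1 divff.
  - by rewrite -mulr_suml sumrB -mulr_sumr colM colP mulr1 divff.
  - apply: contraNT => ns; have /eqP M00 : M s c == 0 by apply: contraNT ns => /suppM.
    have /eqP P00 : perm_plan R sigma s c == 0 by apply: contraNT ns => /suppP.
    by rewrite /M' M00 P00 mulr0 subr0 mul0r.
have inB N : plan N -> dsqo R 3 (qso_of_plan N).
  by move=> pN; apply/dsqo3P; split; [exact: qso_of_plan_qso | move=> k; exact: qso_of_plan_U1].
have VE : V = qso_of_plan M by apply/ffunP => k; rewrite VM.
have [|PV _] := extrV _ _ (inB _ planP) (inB _ planM') t _ (etrans VE (qso_of_plan_convex ME)).
  by rewrite t0.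
by exists sigma; split.
Qed.

(** * Half-integral points *)

Lemma sum_perm_plan (R : realType) (m : nat) (sigma : cell m -> cell m) k c :
  injective sigma ->
  \sum_h perm_plan R sigma (k, h) c = 0 \/ \sum_h perm_plan R sigma (k, h) c = 1.
Proof.
move=> inj; have [/existsP[h /eqP <-]|/existsPn none] := boolP [exists h, sigma (k, h) == c].
  right; rewrite (bigD1 h) //= /perm_plan eqxx big1 ?addr0 // => h' ne.
  by rewrite (inj_eq inj) xpair_eqE eqxx (negPf ne).
by left; rewrite big1 // => h _; rewrite /perm_plan (negPf (none h)).
Qed.

Section HalfIntegral.
Variable R : realType.

(** The integral points in the coordinates a_ii and 2 a_ij (i < j). *)
Definition half_integral (m : nat) (A : 'M[R]_m) :=
  (forall i, A i i = 0 \/ A i i = 1) /\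
  (forall i j, [\/ A i j = 0, A i j = 2^-1 | A i j = 1]).

Lemma perm_plan_half_integral (m : nat) (sigma : cell m -> cell m) k :
  injective sigma -> half_integral (qso_of_plan (perm_plan R sigma) k).
Proof.
move=> inj; split=> [i|i j]; rewrite qso_of_planE.
  by have [->|->] := sum_perm_plan R k (i, i) inj; [left|right]; lra.
have [->|->] := sum_perm_plan R k (i, j) inj; have [->|->] := sum_perm_plan R k (j, i) inj.
- by apply: Or31; lra.
- by apply: Or32; lra.
- by apply: Or32; lra.
- by apply: Or33; lra.
Qed.

Lemma U1_convex (m : nat) (A B : 'M[R]_m) t :
  U1 R m A -> U1 R m B -> 0 <= t <= 1 -> U1 R m (t *: A + (1 - t) *: B).
Proof.
move=> [symA A0 Aa AT] [symB B0 Ba BT] /andP[t0 t1].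
have t1' : 0 <= 1 - t by rewrite subr_ge0.
have sumE (P : pred 'I_m) : \sum_(i | P i) \sum_(j | P j) (t *: A + (1 - t) *: B) i j =
   t * \sum_(i | P i) \sum_(j | P j) A i j + (1 - t) * \sum_(i | P i) \sum_(j | P j) B i j.
  rewrite !mulr_sumr -big_split; apply: eq_bigr => i _.
  rewrite !mulr_sumr -big_split; apply: eq_bigr => j _.
  by rewrite !mxE.
split=> [i j|i j|alpha|].
- by rewrite !mxE symA symB.
- by rewrite !mxE addr_ge0 ?mulr_ge0.
- rewrite sumE; apply: (@le_trans _ _ (t * #|alpha|%:R + (1 - t) * #|alpha|%:R)).
    by rewrite lerD ?ler_wpM2l.
  by rewrite -mulrDl addrC subrK mul1r.
- by rewrite sumE AT BT -mulrDl addrC subrK mul1r.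
Qed.

Definition center_mx : 'M[R]_3 := \matrix_(i, j) (2^-1 *+ (i != j)).

(** A perturbation moves only entries 1/2 between zero diagonal entries, and at
    least two of them because the total is fixed; so the diagonal vanishes, and
    the total makes the third off-diagonal entry 1/2 as well. *)
Lemma half_integral_extr (A : 'M[R]_3) :
  U1 R 3 A -> half_integral A -> A <> center_mx -> extr (U1 R 3) A.
Proof.
move=> UA [diagA offA] neA; apply: extr_midpoint => //; first exact: U1_convex.
move=> D UAD UAD'.
have symA i j : A i j = A j i by case: UA.
have symD i j : D i j = D j i.
  have [/(_ i j) + _ _ _] := UAD; have [/(_ i j) + _ _ _] := UAD'.
  by rewrite !mxE (symA i j); lra.
have absD i j : - A i j <= D i j <= A i j.
  have [_ /(_ i j) + _ _] := UAD; have [_ /(_ i j) + _ _] := UAD'.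
  by rewrite !mxE; lra.
have diagD i : D i i = 0.
  have := U1_diag_le1 i UAD; have := U1_diag_le1 i UAD'; have := absD i i.
  by rewrite !mxE; case: (diagA i) => ->; lra.
have offD i j : i != j -> D i j = 0 \/ [/\ A i j = 2^-1, A i i = 0 & A j j = 0].
  move=> neij; have := U1_pair_le2 UAD neij; have := U1_pair_le2 UAD' neij.
  have := U1_pair_le2 UA neij; have := absD i j.
  have [_ A0 _ _] := UA; have := A0 i i; have := A0 j j.
  rewrite !mxE !diagD.
  case: (offA i j) => -> *; [by left; lra| |by left; lra].
  case: (diagA i) => Ai; first case: (diagA j) => Aj; first by right.
    by left; lra.
  by left; lra.
have totA := U1_total UA; have := U1_total UAD; rewrite !mxE !diagD => totD.
have [_ A0 _ _] := UA.
have nn0 := A0 0 0; have nn1 := A0 1 1; have nn2 := A0 2 2.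
have isC : A 0 0 = 0 -> A 1 1 = 0 -> A 2 2 = 0 -> A 0 1 = 2^-1 -> A 0 2 = 2^-1 ->
    A 1 2 = 2^-1 -> False.
  move=> *; apply: neA; apply/matrixP; do 2!apply: forall3; rewrite mxE /= ?mulr0n ?mulr1n //.
  - by rewrite symA. 
  - by rewrite symA.
  - by rewrite symA.
have D0 : [/\ D 0 1 = 0, D 0 2 = 0 & D 1 2 = 0].
  have [d01|[a01 a0 a1]] := @offD 0 1 isT; have [d02|[a02 a0' a2]] := @offD 0 2 isT;
  have [d12|[a12 a1' a2']] := @offD 1 2 isT; first [by split; lra | by exfalso; apply: isC; lra].
case: D0 => D01 D02 D12; apply/matrixP; do 2!apply: forall3; rewrite !mxE ?diagD //.
- by rewrite symD.
- by rewrite symD.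
- by rewrite symD.
Qed.

Definition graph_mx (m : nat) (g : 'I_m -> 'I_m) : 'M[R]_m :=
  \matrix_(i, j) (g i == j)%:R.

Lemma graph_mx_row_stochastic (m : nat) (g : 'I_m -> 'I_m) : row_stochastic (graph_mx g).
Proof.
split=> [i j|i]; first by rewrite mxE ler0n.
under eq_bigr do rewrite mxE.
by rewrite (bigD1 (g i)) //= eqxx big1 ?addr0 // => j; rewrite eq_sym => /negPf->.
Qed.

(** With doubled off-diagonal entries listed as (01, 02, 12), the centre
    (1, 1, 1) is the midpoint of (2, 0, 1) and (0, 2, 1); these come from the
    maps 0 -> 1, 1 -> 0, 2 -> 1 and 0 -> 2, 1 -> 2, 2 -> 0. *)
Lemma center_mx_split : exists A B : 'M[R]_3,
  [/\ U1 R 3 A, U1 R 3 B, A <> center_mx & A + B = center_mx + center_mx].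
Proof.
exists (sym_part (graph_mx (fun i => nth 0 [:: 1; 0; 1] i))),
       (sym_part (graph_mx (fun i => nth 0 [:: 2; 2; 0] i))).
split.
- exact/U1_sym_part/graph_mx_row_stochastic.
- exact/U1_sym_part/graph_mx_row_stochastic.
- by move/matrixP/(_ 0 2); rewrite !mxE /= mulr1n; lra.
- by apply/matrixP; do 2!apply: forall3; rewrite !mxE /=; lra.
Qed.

Lemma extr_dsqo_center (V : {ffun 'I_3 -> 'M[R]_3}) (k l : 'I_3) :
  extr (dsqo R 3) V -> k != l -> V k = center_mx -> V l = center_mx -> False.
Proof.
move=> [/dsqo3P[[symV V0 V1] UV] extrV] nekl Vk Vl.
have [A [B [UA UB neA AB]]] := center_mx_split.
pose W (A B : 'M[R]_3) := [ffun h => if h == k then A else if h == l then B else V h].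
have WP A' B' : U1 R 3 A' -> U1 R 3 B' -> A' + B' = center_mx + center_mx -> dsqo R 3 (W A' B').
  move=> UA' UB' AB'; have UW h : U1 R 3 (W A' B' h).
    by rewrite ffunE; case: ifP => // _; case: ifP.
  apply/dsqo3P; split=> //; split=> [i j h|i j h|i j].
  - by have [] := UW h.
  - by have [] := UW h.
  rewrite -(V1 i j) (bigD1 k) // (bigD1 l) 1?eq_sym //=.
  rewrite [RHS](bigD1 k) // [in RHS](bigD1 l) 1?eq_sym //= !ffunE !eqxx eq_sym (negPf nekl).
  rewrite !addrA Vk Vl; move/matrixP/(_ i j): AB'; rewrite !mxE => ->.
  by congr (_ + _); apply: eq_bigr => h /andP[/negPf hk /negPf hl]; rewrite ffunE hk hl.
have WE : V = 2^-1 *: W A B + (1 - 2^-1) *: W B A.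
  apply/ffunP => h; rewrite !ffunE.
  case: (eqVneq h k) => [->|_]; last case: (eqVneq h l) => [->|_].
  - rewrite Vk; apply/matrixP => i j; move/matrixP/(_ i j): AB; rewrite !mxE; lra.
  - rewrite Vl; apply/matrixP => i j; move/matrixP/(_ i j): AB; rewrite !mxE; lra.
  - by rewrite -scalerDl addrC subrK scale1r.
have BA : B + A = center_mx + center_mx by rewrite addrC.
have [|/ffunP/(_ k) + _] := extrV _ _ (WP _ _ UA UB AB) (WP _ _ UB UA BA) 2^-1 _ WE.
  by rewrite invr_gt0 invf_lt1 // ltr0n ltr1n.
by rewrite ffunE eqxx Vk.
Qed.

Lemma extr_dsqo_of_two (V : {ffun 'I_3 -> 'M[R]_3}) (k l : 'I_3) :
  dsqo R 3 V -> k != l -> extr (U1 R 3) (V k) -> extr (U1 R 3) (V l) -> extr (dsqo R 3) V.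
Proof.
move=> dV nekl [_ extrk] [_ extrl]; split=> // Y Z dY dZ t t01 VE.
have [[_ _ V1] _] := dV.
have VEk h : V h = t *: Y h + (1 - t) *: Z h by rewrite VE !ffunE.
have [Yk Zk] := extrk _ _ (dsqo_U1 k isT dY) (dsqo_U1 k isT dZ) t t01 (VEk k).
have [Yl Zl] := extrl _ _ (dsqo_U1 l isT dY) (dsqo_U1 l isT dZ) t t01 (VEk l).
have det W : dsqo R 3 W -> W k = V k -> W l = V l -> W = V.
  move=> [[_ _ W1] _] Wk Wl; apply/ffunP => h.
  have [->//|nek] := eqVneq h k; have [->//|nel] := eqVneq h l.
  apply/matrixP => i j; have := etrans (W1 i j) (esym (V1 i j)).
  have sumE (F : 'I_3 -> R) : \sum_h' F h' = F k + F l + F h.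
    rewrite (bigD1 k) // (bigD1 l) 1?eq_sym // (bigD1 h) /= ?nek ?nel //.
    rewrite big1 ?addr0 ?addrA // => h' /andP[/andP[]].
    by move: k l h h' nekl nek nel {Yk Zk Yl Zl Wk Wl extrk extrl}; do 4!apply: forall3.
  by rewrite !sumE Wk Wl => /addrI.
by split; apply: det.
Qed.
End HalfIntegral.

(** * The characterization *)

Theorem theorem4p8 (R : realType) (V : {ffun 'I_3 -> 'M[R]_3}) (hV : dsqo R 3 V) :
  extr (dsqo R 3) V <->
  exists k l : 'I_3, k != l /\ extr (U1 R 3) (V k) /\ extr (U1 R 3) (V l).
Proof.
split=> [eV|[k [l [nekl [ek el]]]]]; last exact: extr_dsqo_of_two ek el.
have [sigma [inj VE]] := extr_dsqo_perm eV.
have dich k : V k <> center_mx R -> extr (U1 R 3) (V k).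
  apply: half_integral_extr; first exact: dsqo_U1.
  by rewrite VE; exact: perm_plan_half_integral.
have one k l : k != l -> V k = center_mx R -> V l <> center_mx R.
  by move=> nekl Vk Vl; exact: extr_dsqo_center eV nekl Vk Vl.
have [V0|V0] := eqVneq (V 0) (center_mx R).
  by exists 1, 2; split=> //; split; apply: dich; apply: (one 0).
have [V1|V1] := eqVneq (V 1) (center_mx R).
  by exists 0, 2; split=> //; split; apply: dich; [exact/eqP | apply: (one 1)].
by exists 0, 1; split=> //; split; apply: dich; exact/eqP.
Qed.
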